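(* Let $f$ be a partial function with hard distribution $\mu$, and let $m$ be a positive integer. Let $A$ be any randomized algorithm which, when run on an input to $f^{\oplus m}$ drawn from $\mu^{\otimes m}$, makes $T$ queries in expectation and solves $k$ of the $m$ instances of $f$ in expectation (both expectations over $\mu^{\otimes m}$ and the randomness of $A$). Then $T\ge k\,\mathrm{R}_0(f)$.
   Context: $f:\mathrm{Dom}(f)\to\mathcal{Z}$ with $\mathrm{Dom}(f)\subseteq\mathcal{X}^n$ is a partial function over finite alphabets. A randomized query algorithm is a probability distribution over deterministic decision trees. $\mathrm{R}_0(f)$ is the minimum, over randomized algorithms that always output $f(x)$ correctly on every $x\in\mathrm{Dom}(f)$, of the maximum over $x$ of the expected number of queries. A hard distribution for $f$ is a distribution $\mu$ on $\mathrm{Dom}(f)$ such that every zero-error randomized algorithm for $f$ uses at least $\mathrm{R}_0(f)$ expected queries on inputs drawn from $\mu$. The direct sum $f^{\oplus m}(x_1,\dots,x_m)=(f(x_1),\dots,f(x_m))$ on $\mathrm{Dom}(f)^m$. An instance $x_i$ is solved by a run of the algorithm if the queried positions of $x_i$ contain a $z$-certificate for $f(x_i)=z$, i.e., a partial assignment consistent with $x_i$ such that every input in $\mathrm{Dom}(f)$ consistent with it has $f$-value $z$. *)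

(* Defs.v *)
From HB Require Import structures.
From mathcomp Require Import all_boot all_order all_algebra.
From mathcomp Require Import boolp classical_sets reals ereal esum.

Set Implicit Arguments.
Unset Strict Implicit.
Unset Printing Implicit Defensive.

Import Order.TTheory GRing.Theory Num.Theory.
Local Open Scope ring_scope.

(* The value None means "outside Dom(f)". *)
Definition pfun (I X Z : finType) := {ffun I -> X} -> option Z.

Definition dom (I X Z : finType) (f : pfun I X Z) : pred {ffun I -> X} :=
  fun x => f x != None.

Inductive dtree (I X Z : Type) : Type :=
| Leaf of Z
| Query of I & (X -> dtree I X Z).
Arguments Leaf {I X Z}.
Arguments Query {I X Z}.

(* esum requires its index type to be a choiceType. *)
HB.instance Definition _ (I X Z : Type) := gen_eqMixin (dtree I X Z).
HB.instance Definition _ (I X Z : Type) := gen_choiceMixin (dtree I X Z).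

Section Trees.
Variables (I X : finType) (Z : Type).

Fixpoint output (t : dtree I X Z) (x : {ffun I -> X}) : Z :=
  match t with
  | Leaf z => z
  | Query i k => output (k (x i)) x
  end.

(* Trees may query a position more than once; each query is then counted. *)
Fixpoint queried (t : dtree I X Z) (x : {ffun I -> X}) : seq I :=
  match t with
  | Leaf _ => [::]
  | Query i k => i :: queried (k (x i)) x
  end.

End Trees.

(* A randomized algorithm for g: a discrete (possibly infinitely supported)   *)
(* probability distribution over the decision trees that read inputs of g and *)
(* output values of g.  No correctness is required.                           *)
Record ralg (R : realType) (I X Z : finType) (g : pfun I X Z) := RAlg {
  tprob :> dtree I X Z -> R;
  tprob_ge0 : forall t, 0 <= tprob t;
  tprob_sum1 : (\esum_(t in [set: dtree I X Z]%classic) (tprob t)%:E = 1)%E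
}.

Record idist (R : realType) (I X Z : finType) (g : pfun I X Z) := IDist {
  iprob :> {ffun I -> X} -> R;
  iprob_ge0 : forall x, 0 <= iprob x;
  iprob_sum1 : \sum_x iprob x = 1;
  iprob_dom : forall x, ~~ dom g x -> iprob x = 0
}.

Section Expectations.
Variables (R : realType) (I X Z : finType) (g : pfun I X Z).

(* The expectation of F t over the random tree t; F is nat-valued, so this is *)
(* a sum of nonnegative terms, possibly +oo.                                  *)
Definition ealg (A : ralg R g) (F : dtree I X Z -> nat) : \bar R :=
  (\esum_(t in [set: dtree I X Z]%classic) (A t * (F t)%:R)%:E)%E.

Definition exp_queries (A : ralg R g) (x : {ffun I -> X}) : \bar R :=
  ealg A (fun t => size (queried t x)).

Definition avg_queries (mu : idist R g) (A : ralg R g) : \bar R :=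
  (\sum_x (mu x)%:E * exp_queries A x)%E.

Definition zero_error (A : ralg R g) : Prop :=
  forall t, A t != 0 -> forall x, dom g x -> g x = Some (output t x).

(* The neutral element 0 is harmless: query counts are nonnegative. *)
Definition max_queries (A : ralg R g) : \bar R :=
  \big[maxe/0%E]_(x | dom g x) exp_queries A x.

End Expectations.

(* The infimum is a minimum: dropping repeated queries from the trees does    *)
(* not increase the cost, and only finitely many trees never repeat a query   *)
(* when outputs are taken in the finite type Z.                               *)
Definition R0 (R : realType) (I X Z : finType) (f : pfun I X Z) : \bar R :=
  ereal_inf
    [set max_queries A | A in [set A : ralg R f | zero_error A]]%classic.

Definition hard (R : realType) (I X Z : finType) (f : pfun I X Z)
    (mu : idist R f) : Prop :=
  forall A : ralg R f, zero_error A -> (R0 R f <= avg_queries mu A)%E.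

Section Certificates.
Variables (I X Z : finType) (f : pfun I X Z).

Definition consistent (rho : {ffun I -> option X}) (x : {ffun I -> X}) : bool :=
  [forall i, (rho i == None) || (rho i == Some (x i))].

Definition certificate (z : Z) (rho : {ffun I -> option X}) : bool :=
  [forall x, dom f x && consistent rho x ==> (f x == Some z)].

Definition contains_certificate (S : {set I}) (x : {ffun I -> X}) : bool :=
  [exists z, (f x == Some z) &&
    [exists rho : {ffun I -> option X},
      [&& [set i | rho i != None] \subset S, consistent rho x
        & certificate z rho]]].

End Certificates.

(* An input to the m-fold direct sum is indexed by pairs (instance, position). *)
Definition block (m : nat) (I X : finType) (x : {ffun 'I_m * I -> X})
  (i : 'I_m) : {ffun I -> X} := [ffun j => x (i, j)].

(* The tuple picked is unique: it exists iff every block lies in Dom(f). *)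
Definition dsum (I X Z : finType) (f : pfun I X Z) (m : nat) :
    pfun ('I_m * I)%type X {ffun 'I_m -> Z} :=
  fun x => [pick z : {ffun 'I_m -> Z} | [forall i, f (block x i) == Some (z i)]].
Arguments dsum {I X Z} f m.

Lemma dom_dsum (I X Z : finType) (f : pfun I X Z) (m : nat)
  (x : {ffun 'I_m * I -> X}) : dom (dsum f m) x = [forall i, dom f (block x i)].
Proof.
rewrite /dom /dsum; case: pickP => [z /forallP fz | nz] /=.
  by apply/esym/forallP => i; rewrite (eqP (fz i)).
apply/esym/negP => /forallP fx.
have fx' i : exists z, f (block x i) == Some z.
  by move: (fx i); case: (f _) => // z _; exists z.
have /negP := negbT (nz [ffun i => xchoose (fx' i)]); apply.
by apply/forallP => i; rewrite ffunE (xchooseP (fx' i)).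
Qed.

Section PowerDistribution.
Variables (R : realType) (I X Z : finType) (f : pfun I X Z).
Variables (mu : idist R f) (m : nat).

Definition mpow (x : {ffun 'I_m * I -> X}) : R := \prod_(i < m) mu (block x i).

Lemma mpow_ge0 x : 0 <= mpow x.
Proof. by apply: prodr_ge0 => i _; exact: iprob_ge0. Qed.

Lemma mpow_sum1 : \sum_x mpow x = 1.
Proof.
pose h (y : {ffun 'I_m -> {ffun I -> X}}) : {ffun 'I_m * I -> X} :=
  [ffun p => y p.1 p.2].
pose h' (x : {ffun 'I_m * I -> X}) : {ffun 'I_m -> {ffun I -> X}} :=
  [ffun i => block x i].
have hK : cancel h h'.
  by move=> y; apply/ffunP => i; apply/ffunP => j; rewrite !ffunE.
have h'K : cancel h' h by move=> x; apply/ffunP => -[i j]; rewrite !ffunE.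
rewrite (reindex h) /=; last by exists h' => ? _.
transitivity (\prod_(i < m) \sum_y mu y); last first.
  by rewrite big1 // => i _; exact: iprob_sum1.
rewrite bigA_distr_bigA /=; apply: eq_bigr => y _; apply: eq_bigr => i _.
by congr (mu _); apply/ffunP => j; rewrite !ffunE.
Qed.

Lemma mpow_dom x : ~~ dom (dsum f m) x -> mpow x = 0.
Proof.
rewrite dom_dsum => /forallPn[i fi].
by rewrite /mpow (bigD1 i) //= iprob_dom // mul0r.
Qed.

Definition dist_pow : idist R (dsum f m) := IDist mpow_ge0 mpow_sum1 mpow_dom.

End PowerDistribution.

Section Solving.
Variables (R : realType) (I X Z : finType) (f : pfun I X Z) (m : nat).

Definition num_solved (t : dtree ('I_m * I)%type X {ffun 'I_m -> Z})
    (x : {ffun 'I_m * I -> X}) : nat :=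
  #|[set i : 'I_m |
      contains_certificate f [set j | (i, j) \in queried t x] (block x i)]|.

Definition avg_solved (nu : idist R (dsum f m)) (A : ralg R (dsum f m)) :
    \bar R :=
  (\sum_x (nu x)%:E * ealg A (fun t => num_solved t x))%E.

End Solving.

(* Main.v *)
(* By linearity it is enough to treat a deterministic tree and one instance   *)
(* i; fixing the other blocks of the input leaves a tree t for f alone. Say t *)
(* makes T expected queries under mu and solves its input with probability p. *)
(* Run t and, only if the input is still unsolved, run a zero-error algorithm *)
(* of worst-case cost at most R0 + e. The result is zero-error, so hardness   *)
(* gives R0 <= T + (1 - p) * (R0 + e), and e -> 0 yields p * R0 <= T.         *)
Require Import Defs.
From mathcomp Require Import all_boot all_order all_algebra.
From mathcomp Require Import boolp classical_sets reals ereal esum.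
(* Imported last so that set0, setT, subsetP, etc. refer to finite sets.      *)
From mathcomp Require Import fsbigop fintype finset lra.

Set Implicit Arguments.
Unset Strict Implicit.
Unset Printing Implicit Defensive.

Import Order.TTheory GRing.Theory Num.Theory.
Local Open Scope ring_scope.

(** The core is the single-instance bound [hard_solves]: under a hard [mu], a tree that solves its
    input with probability p makes at least p * R0 queries on average, whatever it outputs. Were it
    cheaper, running it first and paying about R0 only on unsolved inputs would beat R0 on [mu].
    [completion] builds this combination for each deterministic fallback tree, hardness applies to
    the result ([hard_tree]), and the fallback tree is averaged out afterwards ([sum_ealg_le]).

    For m instances, [mpow_resample] redraws block i independently of the others and [restrict]
    yields a tree for f alone. Queries and solved instances are both additive over the blocks, so
    [hard_num_solved] sums the single-instance bounds. *)

Lemma esumZl (R : realType) (T : choiceType) (D : set T) (r : R)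
    (a : T -> \bar R) : 0 <= r -> (forall i, (0 <= a i)%E) ->
  (\esum_(i in D) (r%:E * a i) = r%:E * \esum_(i in D) a i)%E.
Proof.
move=> r0 a0; rewrite /esum -ereal_supZl//; last first.
  (* [ereal_supZl] asks for a nonempty set of partial sums; the empty sum is one. *)
  by apply/set0P; exists 0%E; exists classical_sets.set0;
    [exact: fsets_set0|rewrite fsbig_set0].
congr ereal_sup; apply/seteqP; split => [_ [F DF <-]|_ [_ [F DF <-] <-]].
  exists (\sum_(x \in F) a x)%E; first by exists F.
  by rewrite ge0_mule_fsumr.
by exists F => //; rewrite ge0_mule_fsumr.
Qed.

(** * Expectations over random trees, and point masses as algorithms *)

Section Averages.
Variables (R : realType) (I X Z : finType) (g : pfun I X Z).

Lemma sum_ealg (J : finType) (w : J -> R) (A : ralg R g)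
    (F : J -> dtree I X Z -> nat) : (forall j, 0 <= w j) ->
  (\sum_j (w j)%:E * ealg A (F j) =
   \esum_(t in [set: dtree I X Z]%classic)
     (A t * \sum_j w j * (F j t)%:R)%:E)%E.
Proof.
move=> w0.
have wF j t : (0 <= (w j)%:E * (A t * (F j t)%:R)%:E)%E.
  by rewrite mule_ge0 ?lee_fin// mulr_ge0 ?tprob_ge0.
transitivity (\sum_j \esum_(t in [set: dtree I X Z]%classic)
    (w j)%:E * (A t * (F j t)%:R)%:E)%E.
  apply: eq_bigr => j _; rewrite esumZl// => t.
  by rewrite lee_fin mulr_ge0 ?tprob_ge0.
rewrite -esum_sum//; apply: eq_esum => t _.
rewrite mulr_sumr -sumEFin; apply: eq_bigr => j _.
by rewrite -EFinM mulrCA.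
Qed.

Lemma sum_ealg_le (w : {ffun I -> X} -> R) (A : ralg R g) F (c : R) :
    (forall x, 0 <= w x) ->
    (forall t, A t != 0 -> c <= \sum_x w x * (F x t)%:R) ->
  (c%:E <= \sum_x (w x)%:E * ealg A (F x))%E.
Proof.
move=> w0 cF; rewrite sum_ealg//.
have F0 t : 0 <= \sum_x w x * (F x t)%:R.
  by apply: sumr_ge0 => x _; rewrite mulr_ge0.
(* [esumZl] needs a nonnegative factor; a negative [c] lies below any sum of nonnegative terms. *)
have [c0|c0] := leP 0 c; last first.
  apply: (@le_trans _ _ 0%E); first by rewrite lee_fin ltW.
  by apply: esum_ge0 => t _; rewrite lee_fin mulr_ge0 ?tprob_ge0.
(* Spread [c] over the total mass of [A], then compare tree by tree. *)
rewrite -[leLHS]mule1 -(tprob_sum1 A) -esumZl//; last first.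
  by move=> t; rewrite lee_fin tprob_ge0.
apply: le_esum => t _; rewrite -EFinM lee_fin mulrC.
have [->|At] := eqVneq (A t) 0; first by rewrite !mul0r.
by rewrite ler_wpM2l ?tprob_ge0 ?cF.
Qed.

Lemma esum_dirac (t : dtree I X Z) (a : dtree I X Z -> R) :
  0 <= a t -> (\esum_(s in [set: dtree I X Z]%classic)
    ((s == t)%:R * a s)%:E = (a t)%:E)%E.
Proof.
move=> a0; rewrite -(@esum_set1 R _ t (fun s => (a s)%:E))// [RHS]esum_mkcond.
apply: eq_esum => s _; case: eqVneq => [->|/eqP st].
  by rewrite mul1r mem_set.
by rewrite mul0r memNset.
Qed.

Lemma dirac_sum1 (t : dtree I X Z) :
  (\esum_(s in [set: dtree I X Z]%classic) (s == t)%:R%:E = 1%:E :> \bar R)%E.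
Proof.
rewrite -(@esum_dirac t (fun=> 1)) ?ler01//.
by apply: eq_esum => s _; rewrite mulr1.
Qed.

Definition det_alg (t : dtree I X Z) : ralg R g :=
  RAlg g (fun s => ler0n R (s == t)) (dirac_sum1 t).

Lemma exp_queries_det t x :
  exp_queries (det_alg t) x = (size (queried t x))%:R%:E.
Proof.
by rewrite -(esum_dirac (a := fun s : dtree I X Z => (size (queried s x))%:R)).
Qed.

Definition tree_correct (t : dtree I X Z) : Prop :=
  forall x, dom g x -> g x = Some (output t x).

Lemma zero_error_det t : tree_correct t -> zero_error (det_alg t).
Proof.
by move=> ct s /=; case: (eqVneq s t) => [-> _|]; [exact: ct | rewrite eqxx].
Qed.

Lemma max_queries_ge0 (A : ralg R g) : (0 <= max_queries A)%E.
Proof. exact: bigmax_ge_id. Qed.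

Lemma exp_queries_le_max (A : ralg R g) x :
  dom g x -> (exp_queries A x <= max_queries A)%E.
Proof. by move=> gx; exact: le_bigmax_cond. Qed.

Lemma R0_ge0 : (0 <= R0 R g)%E.
Proof. by apply: le_ereal_inf_tmp => _ [A _ <-]; exact: max_queries_ge0. Qed.

Lemma hard_tree (mu : idist R g) t : hard mu -> tree_correct t ->
  (R0 R g <= (\sum_x mu x * (size (queried t x))%:R)%:E)%E.
Proof.
move=> hmu ct; apply: le_trans (hmu _ (zero_error_det ct)) _.
rewrite /avg_queries -sumEFin; apply: lee_sum => x _.
by rewrite exp_queries_det EFinM.
Qed.

End Averages.

(** * Completing a tree by a fallback on unsolved inputs *)

Section Completion.
Variables (I X Z : finType) (f : pfun I X Z).
Implicit Types (S : {set I}) (x : {ffun I -> X}).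

Definition restriction S x : {ffun I -> option X} :=
  [ffun i => if i \in S then Some (x i) else None].

Lemma consistent_restriction S x : consistent (restriction S x) x.
Proof. by apply/forallP => i; rewrite ffunE; case: ifP; rewrite eqxx ?orbT. Qed.

(** Among the partial assignments on [S] consistent with [x], the restriction of [x] is the most
    specific, so it is a certificate as soon as any of them is. *)
Lemma contains_certificateE S x : dom f x ->
  contains_certificate f S x = [exists z, certificate f z (restriction S x)].
Proof.
move=> fx; apply/existsP/existsP => -[z].
  case/andP => _ /existsP[rho /and3P[/subsetP sub crx /forallP cert]].
  exists z; apply/forallP => y; apply/implyP => /andP[fy cy].
  apply: (implyP (cert y)); rewrite fy /=; apply/forallP => i.
  have [//|ri] := eqVneq (rho i) None.
  have := forallP cy i; rewrite ffunE sub ?inE//= => /eqP[<-].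
  by have := forallP crx i; rewrite (negPf ri).
move=> cert; exists z; apply/andP; split.
  by apply: (implyP (forallP cert x)); rewrite fx consistent_restriction.
apply/existsP; exists (restriction S x); rewrite consistent_restriction cert.
by rewrite !andbT; apply/subsetP => i; rewrite inE ffunE; case: ifP.
Qed.

Lemma contains_certificateT x : dom f x -> contains_certificate f setT x.
Proof.
move=> fx; rewrite contains_certificateE//; apply/existsP.
move: fx; rewrite /dom; case fxE: (f x) => [z|]// _; exists z.
apply/forallP => y; apply/implyP => /andP[_ /forallP cy].
suff -> : y = x by rewrite fxE.
by apply/ffunP => i; have := cy i; rewrite ffunE inE => /eqP[->].
Qed.

(** [Z'] is left free because the trees to be completed come from direct-sum algorithms or from
    [read_all], whose outputs are not values of [f]. *)
Definition solves (Z' : Type) (t : dtree I X Z') x : bool :=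
  contains_certificate f [set i | i \in queried t x] x.

(* rho records the answers received so far.                                   *)
Fixpoint complete (Z' : Type) (t' : dtree I X Z) (t : dtree I X Z')
    (rho : {ffun I -> option X}) : dtree I X Z :=
  match t with
  | Leaf _ => if [pick z | certificate f z rho] is Some z then Leaf z else t'
  | Query i k => Query i (fun a =>
      complete t' (k a) [ffun j => if j == i then Some a else rho j])
  end.

Lemma restrictionU1 S x i :
  [ffun j => if j == i then Some (x i) else restriction S x j] =
  restriction (i |: S) x.
Proof.
by apply/ffunP => j; rewrite !ffunE !inE; case: eqVneq => [->|].
Qed.


(** Along the path of [x], [rho] stays the restriction of [x] to the positions read so far; [S] is
    general so that the induction can let it grow. At a leaf, either a certificate forces the value
    or [x] is unsolved and [t'] answers. *)
Lemma complete_correct (Z' : Type) t' (t : dtree I X Z') S x : dom f x ->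
    (~~ contains_certificate f (S :|: [set i | i \in queried t x]) x ->
      f x = Some (output t' x)) ->
  f x = Some (output (complete t' t (restriction S x)) x).
Proof.
move=> fx; elim: t S => [z|i k IH] S /= ct'.
  case: pickP => [z' cert|nocert] /=.
    apply/eqP; apply: (implyP (forallP cert x)).
    by rewrite fx consistent_restriction.
  apply: ct'; rewrite contains_certificateE// set_nil setU0.
  by apply/existsPn => z'; rewrite nocert.
rewrite restrictionU1; apply: IH => unsolved; apply: ct'.
by rewrite set_cons setUCA setUA.
Qed.

Lemma queried_complete (Z' : Type) t' (t : dtree I X Z') S x : dom f x ->
  queried (complete t' t (restriction S x)) x = queried t x ++
    if contains_certificate f (S :|: [set i | i \in queried t x]) x
    then [::] else queried t' x.
Proof.
move=> fx; elim: t S => [z|i k IH] S /=.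
  rewrite set_nil setU0 contains_certificateE//.
  case: pickP => [z' cert|nocert].
    by case: existsP => // -[]; exists z'.
  by case: existsP => // -[z']; rewrite nocert.
by rewrite restrictionU1 IH set_cons setUCA setUA.
Qed.

Definition completion (Z' : Type) (t' : dtree I X Z) (t : dtree I X Z') :=
  complete t' t [ffun=> None].

Lemma restriction0 x : [ffun=> None] = restriction set0 x.
Proof. by apply/ffunP => i; rewrite !ffunE inE. Qed.

Lemma completion_correct (Z' : Type) t' (t : dtree I X Z') :
    (forall x, dom f x -> ~~ solves t x -> f x = Some (output t' x)) ->
  tree_correct f (completion t' t).
Proof.
move=> ct' x fx; rewrite /completion (restriction0 x).
by apply: complete_correct => //; rewrite set0U; exact: ct'.
Qed.

Lemma size_queried_completion (Z' : Type) t' (t : dtree I X Z') x : dom f x ->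
  size (queried (completion t' t) x) =
  (size (queried t x) + ~~ solves t x * size (queried t' x))%N.
Proof.
move=> fx; rewrite /completion (restriction0 x) queried_complete// set0U.
by rewrite size_cat /solves; case: ifP; rewrite ?mul0n ?mul1n.
Qed.

Definition read_all : dtree I X unit :=
  foldr (fun i t => Query i (fun=> t)) (Leaf tt) (enum I).

Lemma queried_read_all x : queried read_all x = enum I.
Proof. by rewrite /read_all; elim: (enum I) => //= i s ->. Qed.

Lemma solves_read_all x : dom f x -> solves read_all x.
Proof.
move=> fx; rewrite /solves (_ : finset _ = setT) ?contains_certificateT//.
by apply/setP => i; rewrite !inE queried_read_all mem_enum.
Qed.

End Completion.

(** * The single-instance bound *)

Section HardDistribution.
Variables (R : realType) (I X Z : finType) (f : pfun I X Z).
Variables (mu : idist R f).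

Lemma R0_fin_num : R0 R f \is a fin_num.
Proof.
rewrite ge0_fin_numE ?R0_ge0//.
(* A leaf needs some output: a point of nonzero mass lies in the domain, and its value serves. *)
have [z _] : exists z : Z, true.
  have /existsP[x] : [exists x, mu x != 0].
    apply/existsPn => mu0; have /eqP := iprob_sum1 mu.
    by rewrite big1 1?eq_sym ?oner_eq0// => x _; apply/eqP/negPn/mu0.
  have [|/iprob_dom ->] := boolP (dom f x); last by rewrite eqxx.
  by rewrite /dom; case: (f x) => // z _ _; exists z.
(* [Leaf z] is never reached on the domain, since reading everything solves every input there. *)
pose t := completion f (Leaf z) (read_all I X).
have ct : tree_correct f t.
  by apply: completion_correct => x fx; rewrite solves_read_all.
apply: (@le_lt_trans _ _ (#|I|%:R)%:E); last exact: ltry.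
apply: (@le_trans _ _ (max_queries (det_alg R f t))).
  apply: ereal_inf_lbound; exists (det_alg R f t) => //.
  exact: zero_error_det.
apply: bigmax_le => [|x fx]; first by rewrite lee_fin.
rewrite exp_queries_det size_queried_completion// solves_read_all//.
by rewrite mul0n addn0 queried_read_all -cardE.
Qed.

Lemma hard_solves (Z' : Type) (t : dtree I X Z') : hard mu ->
  fine (R0 R f) * (\sum_x mu x * (solves f t x)%:R) <=
  \sum_x mu x * (size (queried t x))%:R.
Proof.
move=> hmu; set r := fine _; set p := \sum_x _; set T := \sum_x _.
have rE : R0 R f = r%:E by rewrite fineK// R0_fin_num.
have p0 : 0 <= p by apply: sumr_ge0 => x _; rewrite mulr_ge0 ?iprob_ge0.
apply/ler_addgt0Pr => e e0.
(* [A] is a zero-error algorithm of worst-case cost below R0 + e. *)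
have [_ [A zA <-]] := lb_ereal_inf_adherent e0 R0_fin_num.
rewrite -/(R0 R f) rE -EFinD => Alt.
pose w x := mu x * (~~ solves f t x)%:R.
have w0 x : 0 <= w x by rewrite mulr_ge0 ?iprob_ge0.
have sum_w : \sum_x w x = 1 - p.
  rewrite -(iprob_sum1 mu) -sumrB; apply: eq_bigr => x _.
  by rewrite /w; case: solves; rewrite ?mulr1 ?mulr0 ?subrr ?subr0.
(* Each tree of [A], used as fallback, gives a correct tree of average cost T plus the fallback cost
   on unsolved inputs; hardness bounds this below by r. *)
have lower t' : A t' != 0 ->
    r - T <= \sum_x w x * (size (queried t' x))%:R.
  move=> At'; rewrite lerBlDl -lee_fin -rE.
  have ct' := completion_correct (t := t) (fun x fx _ => zA t' At' x fx).
  apply: le_trans (hard_tree hmu ct') _.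
  rewrite lee_fin -big_split/=; apply: ler_sum => x _.
  have [fx|fx] := boolP (dom f x); last by rewrite /w iprob_dom// !mul0r addr0.
  by rewrite size_queried_completion// natrD natrM mulrDr mulrA.
have := sum_ealg_le w0 lower.
(* On average over its trees, [A] costs at most r + e on each input of the domain, and the unsolved
   inputs have mass 1 - p. *)
have upper : (\sum_x (w x)%:E * exp_queries A x <= ((1 - p) * (r + e))%:E)%E.
  rewrite -sum_w mulr_suml -sumEFin; apply: lee_sum => x _.
  rewrite [leRHS]EFinM.
  have [fx|fx] := boolP (dom f x); last by rewrite /w iprob_dom// mul0r !mul0e.
  rewrite lee_wpmul2l ?lee_fin//; apply: le_trans (ltW Alt).
  exact: exp_queries_le_max.
move=> /le_trans/(_ upper); rewrite lee_fin => ineq.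
(* From r - T <= (1 - p) * (r + e) one gets r * p <= T + e - p * e. *)
have pe : 0 <= p * e by rewrite mulr_ge0// ltW.
by lra.
Qed.

End HardDistribution.

(** * From one instance to m independent blocks *)

Section Blocks.
Variables (R : realType) (I X Z : finType) (f : pfun I X Z).
Variables (mu : idist R f) (m : nat).
Implicit Types (x : {ffun 'I_m * I -> X}) (z : {ffun I -> X}) (i : 'I_m).

Definition set_block x i z : {ffun 'I_m * I -> X} :=
  [ffun p => if p.1 == i then z p.2 else x p].

Lemma block_set_block x i z i' :
  block (set_block x i z) i' = if i' == i then z else block x i'.
Proof. by apply/ffunP => j; rewrite !ffunE/=; case: ifP; rewrite ?ffunE. Qed.

Lemma set_block_block x i z : set_block (set_block x i z) i (block x i) = x.
Proof.
by apply/ffunP => -[i' j]; rewrite !ffunE/=; case: eqVneq => // ->.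
Qed.

(** Both sides are the product of [mu] over the same m + 1 inputs: the blocks of [x] and [z]. *)
Lemma mpow_set_block x i z :
  mpow mu (set_block x i z) * mu (block x i) = mpow mu x * mu z.
Proof.
rewrite /mpow (bigD1 i)//= [in RHS](bigD1 i)//= block_set_block eqxx.
rewrite [X in _ * X * _ = _](eq_bigr (fun j => mu (block x j))); last first.
  by move=> j /negPf ji; rewrite block_set_block ji.
by rewrite mulrAC [RHS]mulrC mulrA.
Qed.

(* Swapping z with the i-th block of x is a measure-preserving involution.    *)
Lemma mpow_resample i (G : {ffun 'I_m * I -> X} -> R) :
  \sum_x mpow mu x * G x =
  \sum_x mpow mu x * \sum_z mu z * G (set_block x i z).
Proof.
transitivity (\sum_(q : {ffun 'I_m * I -> X} * {ffun I -> X})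
    mpow mu q.1 * mu q.2 * G q.1).
  rewrite -(pair_bigA _ (fun x z => mpow mu x * mu z * G x))/=.
  apply: eq_bigr => x _; rewrite -[LHS]mulr1 -(iprob_sum1 mu) mulr_sumr.
  by apply: eq_bigr => z _; rewrite mulrAC.
pose swap (q : {ffun 'I_m * I -> X} * {ffun I -> X}) :=
  (set_block q.1 i q.2, block q.1 i).
have swapK : involutive swap.
  by move=> [x z]; rewrite /swap/= set_block_block block_set_block eqxx.
rewrite (reindex_inj (inv_inj swapK))/=.
rewrite -(pair_bigA _ (fun x z => mpow mu (set_block x i z) * mu (block x i) *
  G (set_block x i z)))/=.
apply: eq_bigr => x _; rewrite mulr_sumr; apply: eq_bigr => z _.
by rewrite mpow_set_block mulrA.
Qed.

Fixpoint restrict (Z' : Type) i x (t : dtree ('I_m * I) X Z') : dtree I X Z' :=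
  match t with
  | Leaf a => Leaf a
  | Query p k => if p.1 == i then Query p.2 (fun a => restrict i x (k a))
                 else restrict i x (k (x p))
  end.

Lemma queried_restrict (Z' : Type) i x (t : dtree ('I_m * I) X Z') z :
  queried (restrict i x t) z =
  [seq p.2 | p <- queried t (set_block x i z) & p.1 == i].
Proof.
elim: t => //= p k IH; rewrite ffunE.
by case: ifP => _ /=; rewrite IH.
Qed.

(** Each query falls in exactly one block. *)
Lemma size_queried_restrict (Z' : Type) (t : dtree ('I_m * I) X Z') x :
  size (queried t x) =
  (\sum_(i < m) size [seq p.2 | p <- queried t x & p.1 == i])%N.
Proof.
elim: (queried t x) => [|p s IH] /=; first by rewrite big1.
rewrite IH [RHS](bigD1 p.1)//= eqxx /= addSn [in LHS](bigD1 p.1)//=.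
by congr (_ + _).+1%N; apply: eq_bigr => i /negPf; rewrite eq_sym => ->.
Qed.

Lemma solves_restrict (Z' : Type) (t : dtree ('I_m * I) X Z') i x z :
  solves f (restrict i x t) z =
  contains_certificate f
    [set j | (i, j) \in queried t (set_block x i z)]
    (block (set_block x i z) i).
Proof.
rewrite block_set_block eqxx /solves; congr contains_certificate.
apply/setP => j; rewrite !inE queried_restrict; apply/mapP/idP.
  by case=> -[i' j']; rewrite mem_filter /= => /andP[/eqP -> ?] ->.
by move=> ij; exists (i, j) => //; rewrite mem_filter /= eqxx.
Qed.

(** After block i is resampled, the inner average over [z] is that of a single instance with the
    other blocks fixed, so [hard_solves] applies to [restrict i x t]. *)
Lemma hard_num_solved (t : dtree ('I_m * I) X {ffun 'I_m -> Z}) : hard mu ->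
  fine (R0 R f) * (\sum_x mpow mu x * (num_solved f t x)%:R) <=
  \sum_x mpow mu x * (size (queried t x))%:R.
Proof.
move=> hmu.
have split (G : 'I_m -> {ffun 'I_m * I -> X} -> nat) :
    \sum_x mpow mu x * (\sum_(i < m) G i x)%N%:R =
    \sum_(i < m) \sum_x mpow mu x * \sum_z mu z * (G i (set_block x i z))%:R.
  rewrite (eq_bigr (fun x => \sum_(i < m) mpow mu x * (G i x)%:R)).
    by rewrite exchange_big; apply: eq_bigr => i _; exact: mpow_resample.
  by move=> x _; rewrite natr_sum mulr_sumr.
pose solved i x := contains_certificate f
  [set j | (i, j) \in queried t x] (block x i).
rewrite (eq_bigr (fun x => mpow mu x * (\sum_(i < m) solved i x)%N%:R)).
  under [leRHS]eq_bigr do rewrite size_queried_restrict.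
  rewrite !split mulr_sumr; apply: ler_sum => i _.
  rewrite mulr_sumr; apply: ler_sum => x _; rewrite mulrCA.
  rewrite ler_wpM2l ?mpow_ge0//.
  have := hard_solves (restrict i x t) hmu.
  under eq_bigr do rewrite solves_restrict.
  by under [leRHS]eq_bigr do rewrite queried_restrict.
by move=> x _; rewrite /num_solved cardsE -sum1_card big_mkcond; congr (_ * _%:R);
  apply: eq_bigr => i _; rewrite unfold_in -/(solved i x); case: solved.
Qed.

End Blocks.

Theorem theorem18 (R : realType) (X Z : finType) (n : nat)
    (f : pfun 'I_n X Z) (mu : idist R f) (hmu : hard mu)
    (m : nat) (hm : (0 < m)%N) (A : ralg R (dsum f m)) :
  (avg_solved (dist_pow mu m) A * R0 R f <= avg_queries (dist_pow mu m) A)%E.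
Proof.
have r0 : 0 <= fine (R0 R f) by rewrite fine_ge0 ?R0_ge0.
rewrite -(fineK (R0_fin_num mu)) /avg_solved /avg_queries muleC.
(* Both averages become sums over the trees of [A], compared term by term. *)
rewrite !sum_ealg; try exact: mpow_ge0.
rewrite -esumZl// => [|t]; last first.
  rewrite lee_fin mulr_ge0 ?tprob_ge0// sumr_ge0// => x _.
  by rewrite mulr_ge0 ?mpow_ge0.
apply: le_esum => t _; rewrite -EFinM lee_fin mulrCA.
by rewrite ler_wpM2l ?tprob_ge0// hard_num_solved.
Qed.
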